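(* Let $n$ be an even positive integer and let $G$ be any abelian group of order $2^{2n+2}$ having an elementary abelian subgroup of index $2$. Then there exists a strictly Neumaier graph that is a Cayley graph over $G$ and has parameters $$(2^{2n+2},\ (2^{n+1}-1)(2^n+1),\ 2(2^n-1)(2^{n-1}+1),\ 2^n,\ 2^{n+1}).$$
   Context: For an identity-free subset $S=S^{-1}$ of a finite group $G$, the Cayley graph $\mathrm{Cay}(G,S)$ over $G$ has vertex set $G$ and the neighbourhood of $g$ is $Sg$. All graphs are finite, simple and undirected. A clique in a regular graph is $m$-regular (with $m$ a positive integer) if every vertex outside the clique is adjacent to exactly $m$ vertices of the clique; a regular clique is a clique that is $m$-regular for some $m\ge1$. A graph is edge-regular with parameters $(v,k,\lambda)$ if it is $k$-regular on $v$ vertices and every pair of adjacent vertices has exactly $\lambda$ common neighbours. It is strongly regular if in addition every pair of distinct non-adjacent vertices has the same number $\mu$ of common neighbours. A Neumaier graph is a non-complete edge-regular graph containing a regular clique; it has parameters $(v,k,\lambda,m,s)$ if it is edge-regular with parameters $(v,k,\lambda)$ and has an $m$-regular clique of size $s$. A strictly Neumaier graph is a Neumaier graph that is not strongly regular. *)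

(* Defs.v *)
From mathcomp Require Import all_boot all_fingroup all_solvable.

Set Implicit Arguments.
Unset Strict Implicit.
Unset Printing Implicit Defensive.

Record sgraph (T : finType) := SGraph {
  adj :> rel T;
  adj_sym : symmetric adj;
  adj_irr : irreflexive adj
}.

Section Graphs.

Variables (T : finType) (X : sgraph T).

Definition neighbours (x : T) : {set T} := [set y | X x y].

Definition complete : Prop := forall x y, x != y -> X x y.

Definition edge_regular_params (v k l : nat) : Prop :=
  [/\ #|T| = v,
      forall x, #|neighbours x| = k
    & forall x y, X x y -> #|neighbours x :&: neighbours y| = l].

Definition edge_regular : Prop := exists v k l, edge_regular_params v k l.

Definition strongly_regular : Prop :=
  edge_regular /\
  exists mu, forall x y, x != y -> ~~ X x y ->
    #|neighbours x :&: neighbours y| = mu.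

Definition clique (C : {set T}) : Prop := {in C &, forall x y, x != y -> X x y}.

Definition regular_clique (m : nat) (C : {set T}) : Prop :=
  [/\ 0 < m, clique C & forall x, x \notin C -> #|neighbours x :&: C| = m].

Definition neumaier : Prop :=
  [/\ ~ complete, edge_regular & exists m C, regular_clique m C].

Definition neumaier_params (v k l m s : nat) : Prop :=
  [/\ neumaier, edge_regular_params v k l
    & exists2 C, regular_clique m C & #|C| = s].

Definition strictly_neumaier : Prop := neumaier /\ ~ strongly_regular.

End Graphs.

(* [S :* g] is the set of all products s * g with s in S, and [S^-1] is the
   set of inverses of the elements of S. *)
Definition is_cayley_graph (gT : finGroupType) (X : sgraph gT) : Prop :=
  exists S : {set gT},
    [/\ 1%g \notin S, (S^-1)%g = S & forall g, neighbours X g = (S :* g)%g].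

(* Main.v *)
(* Write q = 2^n and let E be an elementary abelian group of order q^2 with a
   nondegenerate hyperbolic quadratic form Q. Choose a plane M of E such that
   Q = 1 on M \ {0}, and a quadratic form Q' whose radical is M, vanishing on M.
   Then G splits into four cosets of E indexed by (j, t) in F_2^2, with t = 0 on
   the subgroup H of index 2, and the connection set together with 1 is
     D = {(e, j, 0) | Q e = 0} u {(e, j, 1) | Q' e = j}.
   The autocorrelation of the sign function of D is
     2 q^2 ([h = 0] + (-1)^k [h in M]) at (h, k, 0), and 0 at (h, k, 1).
   It vanishes on D \ {1}, because Q = 1 on M \ {0}: this is edge-regularity.
   It does not vanish on M \ {0}, which is disjoint from D, while it vanishes at
   some other elements outside D: the graph is not strongly regular. The clique
   is the product of a maximal totally singular subspace of E with {(j, 0)}.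
   As Q' is invariant under M, everything still works when the squares of the
   elements outside H are twisted by an element of M; this covers the groups G
   which are not elementary abelian. *)
Require Import Defs.
From HB Require Import structures.
From mathcomp Require Import all_boot all_fingroup all_solvable all_algebra.
From mathcomp Require Import zify ring.

Set Implicit Arguments.
Unset Strict Implicit.
Unset Printing Implicit Defensive.

(** Makes products such as [X], [E] and [T] available as [finZmodType]s. *)
HB.instance Definition _ (U V : finZmodType) := GRing.Zmodule.on (U * V)%type.

(** * Sign sums and orthogonality over F_2 *)

Section SignSums.

Import GRing.Theory.
Local Open Scope ring_scope.

Definition sgn (b : 'F_2) : int := if b == 0 then 1 else -1.

Lemma sgnD (a b : 'F_2) : sgn (a + b) = sgn a * sgn b.
Proof. by case: a => [[|[|]] ?] //; case: b => [[|[|]] ?]. Qed.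

Lemma sgn_eq0 (b : 'F_2) : 1 + sgn b = (b == 0)%:R * 2.
Proof. by rewrite /sgn; case: (b == 0). Qed.

Lemma F2_addrr (a : 'F_2) : a + a = 0.
Proof. by case: a => [[|[|]] ?] //; apply/val_inj. Qed.

Lemma F2_neq0 (a : 'F_2) : a != 0 -> a = 1.
Proof. by case: a => [[|[|]] ?] // _; apply/val_inj. Qed.

Lemma natr_card (T : finType) (A : {set T}) :
  #|A|%:R = \sum_x (x \in A)%:R :> int.
Proof.
by rewrite -sum1_card natr_sum big_mkcond /=; apply: eq_bigr => x _; case: ifP.
Qed.

Lemma natr_cardT (T : finType) : #|T|%:R = \sum_(x : T) 1 :> int.
Proof. by rewrite -sum1_card natr_sum. Qed.

Lemma card_F2_zeros (T : finType) (F : T -> 'F_2) :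
  (#|[set x | F x == 0]| * 2)%:R = #|T|%:R + \sum_x sgn (F x).
Proof.
rewrite natrM natr_card natr_cardT mulr_suml -big_split /=.
by apply: eq_bigr => x _; rewrite inE sgn_eq0.
Qed.

(** With [a] and [b] the values of a quadratic form at e and h, and [d] its polar form there, this
    turns an autocorrelation into a character sum. *)
Lemma sgn_polar (a b d : 'F_2) : sgn a * sgn (a + b + d) = sgn b * sgn d.
Proof. by rewrite -!sgnD !addrA F2_addrr add0r. Qed.

Section Orthogonality.

Variables (V : finZmodType) (dot : V -> V -> 'F_2).
Hypotheses
  (dotDl : forall x x' u, dot (x + x') u = dot x u + dot x' u)
  (dotDr : forall x u u', dot x (u + u') = dot x u + dot x u')
  (dot_nondeg : forall u, u != 0 -> exists x, dot x u = 1).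

Lemma dotx0 (x : V) : dot x 0 = 0.
Proof. by rewrite -[X in dot x X]addr0 dotDr F2_addrr. Qed.

(** For nonzero [u], translating by some [x0] with [dot x0 u = 1] flips every sign, so the sum
    equals its own negative. *)
Lemma sum_sgn_dot (u : V) : \sum_x sgn (dot x u) = #|V|%:R *+ (u == 0)%R.
Proof.
have [->|/dot_nondeg[x0 dx0]] := eqVneq u 0.
  rewrite -sum1_card natr_sum; apply: eq_bigr => x _.
  by rewrite dotx0.
rewrite mulr0n; set S := (LHS).
suff: S = - S by move/esym/eqP; rewrite Num.Theory.eqNr => /eqP.
rewrite {1}/S (reindex_inj (addrI x0)) /= /S -sumrN; apply: eq_bigr => x _.
by rewrite dotDl sgnD dx0 mulN1r.
Qed.

End Orthogonality.

Lemma big_F2 (G : 'F_2 -> int) : \sum_t G t = G 0 + G 1.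
Proof.
rewrite (bigD1 0) //= (bigD1 1) //= big1 ?addr0 // => t /andP[t0 t1].
by rewrite (F2_neq0 t0) eqxx in t1.
Qed.

Lemma card_F2 : #|'F_2| = 2%N. Proof. exact: card_Fp. Qed.

Lemma int_eqNr (x : int) : x = - x -> x = 0.
Proof. by move/esym/eqP; rewrite Num.Theory.eqNr => /eqP. Qed.

End SignSums.

(** * Regularity of Cayley graphs with connection set [D] minus 1 *)

Section CayleyGraph.

Variables (gT : finGroupType) (D : {set gT}).
Hypotheses (D1 : 1%g \in D) (DV : (D^-1)%g = D).

(** Keeping 1 in [D] makes this an autocorrelation count; common neighbours of g and h are obtained
    from it at [w = g * h^-1] by removing 1 and [w^-1]. *)
Definition shared (w : gT) : {set gT} := [set v in D | (v * w)%g \in D].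

Lemma mem_invD (x : gT) : ((x^-1)%g \in D) = (x \in D).
Proof. by rewrite -{1}DV inE invgK. Qed.

Definition cayley_rel (g h : gT) : bool := (h * g^-1)%g \in D :\ 1%g.

Lemma cayley_rel_sym : symmetric cayley_rel.
Proof.
move=> g h; rewrite /cayley_rel !inE -!eq_mulgV1 eq_sym.
by rewrite -mem_invD invMg invgK.
Qed.

Lemma cayley_rel_irr : irreflexive cayley_rel.
Proof. by move=> g; rewrite /cayley_rel mulgV !inE eqxx. Qed.

Definition cayley := SGraph cayley_rel_sym cayley_rel_irr.

Lemma cayleyE g h : cayley g h = ((h != g) && ((h * g^-1)%g \in D)).
Proof. by rewrite /= /cayley_rel !inE -eq_mulgV1. Qed.

Lemma neighbours_cayley g : neighbours cayley g = ((D :\ 1%g) :* g)%g.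
Proof. by apply/setP=> h; rewrite inE mem_rcoset. Qed.

Lemma cayley_is_cayley : is_cayley_graph cayley.
Proof.
exists (D :\ 1%g); split; [by rewrite !inE eqxx | | exact: neighbours_cayley].
by apply/setP=> x; rewrite !inE mem_invD invg_eq1.
Qed.

Lemma card_neighbours_cayley g : #|neighbours cayley g| = #|D|.-1.
Proof. by rewrite neighbours_cayley card_rcoset [#|D|](cardsD1 1%g) D1. Qed.

Lemma common_neighbours_cayley g h :
  #|neighbours cayley g :&: neighbours cayley h|
    = #|shared (g * h^-1)%g :\: [set 1%g; (h * g^-1)%g]|.
Proof.
rewrite -[RHS](card_rcoset _ g); apply: eq_card => u.
rewrite inE !neighbours_cayley !mem_rcoset !inE mulgA mulgKV negb_or.
rewrite -!eq_mulgV1 (inj_eq (mulIg g^-1)%g).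
by rewrite -!andbA; do !bool_congr; case: (u == g); case: (u == h).
Qed.

(** For an edge both removed points lie in the shared set, hence the [- 2]; for a non-edge, treated
    next, neither does. *)
Lemma card_common_adj g h : cayley g h ->
  #|neighbours cayley g :&: neighbours cayley h| = #|shared (g * h^-1)%g| - 2.
Proof.
rewrite cayleyE => /andP[neq_hg Dhg].
rewrite common_neighbours_cayley cardsD (setIidPr _) ?cards2 1?eq_sym.
  by rewrite -eq_mulgV1 neq_hg.
apply/subsetP=> x; rewrite !inE => /orP[]/eqP->.
  by rewrite D1 mul1g -mem_invD invMg invgK.
by rewrite Dhg mulgA mulgKV mulgV.
Qed.

Lemma card_common_nonadj g h : g != h -> ~~ cayley g h ->
  #|neighbours cayley g :&: neighbours cayley h| = #|shared (g * h^-1)%g|.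
Proof.
rewrite cayleyE eq_sym => -> /= nDhg.
rewrite common_neighbours_cayley; congr #|pred_of_set _|.
apply/setP=> x; rewrite !inE.
have [->|_] := eqVneq x 1%g.
  by rewrite mul1g -[(g * _)%g \in D]mem_invD invMg invgK (negPf nDhg) andbF.
by have [->|_] := eqVneq x; rewrite ?(negPf nDhg).
Qed.

(** The elements [w1] and [w2] are both non-adjacent to 1; their differing counts refute strong
    regularity. *)
Lemma cayley_strictly_neumaier (C : {group gT}) (k l m : nat) (w1 w2 : gT) :
    #|D| = k.+1 ->
    (forall w, w \in D -> w != 1%g -> #|shared w| = l.+2) ->
    C \subset D -> 0 < m ->
    (forall g, g \notin C -> #|D :&: (C :* g)%g| = m) ->
    w1 \notin D -> w2 \notin D -> #|shared w1| <> #|shared w2| ->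
  [/\ is_cayley_graph cayley, strictly_neumaier cayley
    & neumaier_params cayley #|gT| k l m #|C|].
Proof.
move=> cardD cnt CD m_gt0 regC nDw1 nDw2 neq12.
have er : edge_regular_params cayley #|gT| k l.
  split=> // [x|x y adj_xy]; first by rewrite card_neighbours_cayley cardD.
  rewrite card_common_adj // cnt ?subn2 //.
    by rewrite -mem_invD invMg invgK; move: adj_xy; rewrite cayleyE => /andP[].
  by rewrite -eq_mulgV1 eq_sym; move: adj_xy; rewrite cayleyE => /andP[].
have rc : regular_clique cayley m C.
  split=> // [x y Cx Cy neq_xy|x nCx].
    by rewrite cayleyE eq_sym neq_xy (subsetP CD) // groupM ?groupV.
  (* Right translation by [x] carries [D :&: (C :* x^-1)] onto the neighbours of [x] in [C]; the
     element 1 causes no loss since [x] is outside [C]. *)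
  have nCV : (x^-1)%g \notin C by rewrite groupV.
  rewrite -(regC _ nCV) -[RHS](card_rcoset _ x); apply: eq_card => u.
  rewrite neighbours_cayley !inE !mem_rcoset !inE !mem_rcoset invgK mulgKV.
  by rewrite -eq_mulgV1; case: eqP => [->|]; rewrite ?(negPf nCx) ?andbF.
have nadj w : w \notin D -> ~~ cayley w 1%g.
  by rewrite cayleyE mul1g mem_invD negb_and orbC => ->.
have neq1 w : w \notin D -> w != 1%g by apply: contraNneq => ->.
have neu : neumaier cayley.
  split; [ | by exists #|gT|, k, l | by exists m, C].
  by move/(_ w1 1%g (neq1 _ nDw1)); apply/negP/nadj.
split; [exact: cayley_is_cayley | | by split=> //; exists C].
split=> // -[_ [mu muE]]; apply: neq12.
have muw w : w \notin D -> #|shared w| = mu.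
  by move=> nDw; rewrite -(muE w 1%g) ?neq1 ?nadj // card_common_nonadj
    ?neq1 ?nadj // invg1 mulg1.
by rewrite !muw.
Qed.

End CayleyGraph.

(** * Quadratic forms and autocorrelations in coordinates *)

Section Model.

Import GRing.Theory Num.Theory.
Local Open Scope ring_scope.

Lemma pair_eq0 (A B : finZmodType) (x : A * B) :
  (x == 0) = (x.1 == 0) && (x.2 == 0).
Proof. by case: x. Qed.

Variable m : nat.

(** Here n = m + 2: two coordinates are set apart to hold the plane M. The last pair in [T] is (j,
    t). *)
Definition X : finZmodType := ('F_2 * 'F_2 * 'rV['F_2]_m)%type.
Definition E : finZmodType := (X * X)%type.
Definition T : finZmodType := (E * ('F_2 * 'F_2))%type.

Definition dotU (u v : 'rV['F_2]_m) : 'F_2 := (u *m v^T) 0 0.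

Lemma dotUDl u u' v : dotU (u + u') v = dotU u v + dotU u' v.
Proof. by rewrite /dotU mulmxDl mxE. Qed.

Lemma dotUC u v : dotU u v = dotU v u.
Proof. by rewrite /dotU -[v in RHS]trmxK -trmx_mul [RHS]mxE. Qed.

Lemma dotUDr u v v' : dotU u (v + v') = dotU u v + dotU u v'.
Proof. by rewrite dotUC dotUDl !(dotUC u). Qed.

Lemma dot0U u : dotU 0 u = 0.
Proof. by rewrite /dotU mul0mx mxE. Qed.

Lemma dotU0 u : dotU u 0 = 0.
Proof. by rewrite dotUC dot0U. Qed.

Definition dotX (x y : X) : 'F_2 :=
  x.1.1 * y.1.1 + x.1.2 * y.1.2 + dotU x.2 y.2.

Lemma dotXDl x x' y : dotX (x + x') y = dotX x y + dotX x' y.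
Proof. by rewrite /dotX /= dotUDl; ring. Qed.

Lemma dotXC x y : dotX x y = dotX y x.
Proof. by rewrite /dotX dotUC mulrC (mulrC x.1.2). Qed.

Lemma dotXDr x y y' : dotX x (y + y') = dotX x y + dotX x y'.
Proof. by rewrite dotXC dotXDl !(dotXC x). Qed.

Lemma dotX_nondeg (y : X) : y != 0 -> exists x, dotX x y = 1.
Proof.
case: y => -[y1 y2] v; rewrite /dotX /= => nz.
have [z1|/F2_neq0->] := eqVneq y1 0; last first.
  by exists (1, 0, 0); rewrite /= dot0U mul0r mulr1 !addr0.
have [z2|/F2_neq0->] := eqVneq y2 0; last first.
  by exists (0, 1, 0); rewrite /= dot0U mul0r mulr1 addr0 add0r.
have /rV0Pn[j vj] : v != 0 by apply: contraNneq nz => ->; rewrite z1 z2.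
exists (0, 0, delta_mx 0 j).
by rewrite /= /dotU -rowE !mxE (F2_neq0 vj) !mul0r !add0r.
Qed.

Definition dotE (e h : E) : 'F_2 := dotX e.1 h.1 + dotX e.2 h.2.

Lemma dotEDl e e' h : dotE (e + e') h = dotE e h + dotE e' h.
Proof. by rewrite /dotE /= !dotXDl addrACA. Qed.

Lemma dotEDr e h h' : dotE e (h + h') = dotE e h + dotE e h'.
Proof. by rewrite /dotE /= !dotXDr addrACA. Qed.

Lemma dotE_nondeg (h : E) : h != 0 -> exists e, dotE e h = 1.
Proof.
rewrite pair_eq0 negb_and => /orP[]/dotX_nondeg[x xh].
  by exists (x, 0); rewrite /dotE /= xh (dotXC 0) (dotx0 dotXDr) addr0.
by exists (0, x); rewrite /dotE /= xh (dotXC 0) (dotx0 dotXDr) add0r.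
Qed.

Definition Q (e : E) : 'F_2 := dotX e.1 e.2.

Definition swap (h : E) : E := (h.2, h.1).

Lemma Q_polar e h : Q (e + h) = Q e + Q h + dotE e (swap h).
Proof.
by rewrite /Q /dotE /= dotXDl !dotXDr (dotXC e.2 h.1); ring.
Qed.

(* [al] and [be] cut out, in the two hyperbolic planes spanned by the first
   coordinates, a plane [M] on which [Q] is anisotropic. *)
Definition al (e : E) : 'F_2 := e.1.1.2 + e.2.1.2.
Definition be (e : E) : 'F_2 := e.1.1.1 + e.2.1.1 + e.2.1.2.

Definition Q' (e : E) : 'F_2 := al e * be e + dotU e.1.2 e.2.2.

(** Represents the polar form of [Q'] through [dotE], so that its kernel is the radical M. *)
Definition polar' (h : E) : E :=
  ((al h, be h, h.2.2), (al h, be h + al h, h.1.2)).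

Lemma Q'_polar e h : Q' (e + h) = Q' e + Q' h + dotE e (polar' h).
Proof.
rewrite /Q' /dotE /dotX /polar' /al /be /= dotUDl !dotUDr.
by rewrite (dotUC e.2.2); ring.
Qed.

(* The line of the radical of [Q'] that contains the squares of G. *)
Definition scale (a : 'F_2) : E := ((a, 0, 0), (a, 0, 0)).

Lemma polar'_eq0 h :
  (polar' h == 0) = [&& al h == 0, be h == 0, h.1.2 == 0 & h.2.2 == 0].
Proof.
rewrite /polar' !pair_eq0 /=; have [->|_] := eqVneq (al h) 0; rewrite //= addr0.
by case: (be h == 0); rewrite //= andbC.
Qed.

Lemma polar'_scale a : polar' (scale a) == 0.
Proof. by rewrite polar'_eq0 /al /be /= !addr0 F2_addrr !eqxx. Qed.

Lemma Q'_radical h : polar' h == 0 -> Q' h = 0.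
Proof.
rewrite polar'_eq0 /Q' => /and4P[/eqP-> _ /eqP-> _].
by rewrite mul0r dot0U addr0.
Qed.

(** On M one has x2 = y2 and x1 = y1 + y2, so [Q] becomes the anisotropic form y1^2 + y1 y2 +
    y2^2. *)
Lemma Q_radical h : polar' h == 0 -> Q h = 0 -> h = 0.
Proof.
case: h => -[[x1 x2] u] [[y1 y2] v].
rewrite polar'_eq0 /al /be /Q /dotX /= => /and4P[x2y2 xy /eqP-> /eqP->].
rewrite dotU0 addr0; move: x2y2 xy.
have [->|/F2_neq0->] := eqVneq x1 0; have [->|/F2_neq0->] := eqVneq x2 0;
by have [->|/F2_neq0->] := eqVneq y1 0; have [->|/F2_neq0->] := eqVneq y2 0.
Qed.

Lemma sum_sgn_Q h :
  \sum_e sgn (Q e) * sgn (Q (e + h)) = #|E|%:R *+ (h == 0)%R.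
Proof.
transitivity (sgn (Q h) * \sum_e sgn (dotE e (swap h))).
  rewrite mulr_sumr; apply: eq_bigr => e _.
  by rewrite Q_polar sgn_polar.
rewrite (sum_sgn_dot dotEDl dotEDr dotE_nondeg) (_ : (swap h == 0) = (h == 0)).
  have [->|_] := eqVneq h 0; last by rewrite mulr0.
  by rewrite /Q /= (dotx0 dotXDr) mul1r.
by rewrite !pair_eq0 andbC.
Qed.

Lemma sum_sgn_Q' h :
  \sum_e sgn (Q' e) * sgn (Q' (e + h)) = #|E|%:R *+ (polar' h == 0)%R.
Proof.
transitivity (sgn (Q' h) * \sum_e sgn (dotE e (polar' h))).
  rewrite mulr_sumr; apply: eq_bigr => e _.
  by rewrite Q'_polar sgn_polar.
rewrite (sum_sgn_dot dotEDl dotEDr dotE_nondeg).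
by case: (boolP (polar' h == 0)) => [/Q'_radical->|_]; rewrite ?mulr0 ?mul1r.
Qed.

Definition bit (q : T) : 'F_2 :=
  if q.2.2 == 0 then Q q.1 else Q' q.1 + q.2.1.

(* The law of G in coordinates: G is elementary abelian when [zeta = 0], and the
   elements with [t = 1] have order 4 when [zeta = 1]. *)
Definition mulT (zeta : 'F_2) (q r : T) : T :=
  (q.1 + (r.1 + scale (zeta * q.2.2 * r.2.2)), q.2 + r.2).

Lemma sum_T (G : T -> int) :
  \sum_q G q = \sum_e (G (e, (0, 0)) + G (e, (1, 0)))
             + \sum_e (G (e, (0, 1)) + G (e, (1, 1))).
Proof.
transitivity (\sum_e \sum_t \sum_j G (e, (j, t))).
  under [RHS]eq_bigr do rewrite exchange_big pair_bigA.
  by rewrite pair_bigA; apply: eq_bigr => -[e [j t]].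
by rewrite -big_split; apply: eq_bigr => e _; rewrite !big_F2.
Qed.

Lemma sum_sgn_bit : \sum_q sgn (bit q) = (#|X| * 2)%N%:R.
Proof.
(* For t = 1 the values j = 0 and j = 1 cancel; for t = 0, summing over x first leaves only y =
   0. *)
rewrite sum_T /bit /= [X in _ + X]big1 ?addr0 => [|e _]; last first.
  by rewrite addr0 sgnD mulrN1 subrr.
rewrite big_split /= -mulr2n -(pair_bigA _ (fun x y => sgn (dotX x y))) /=.
rewrite exchange_big (bigD1 0) //= (sum_sgn_dot dotXDl dotXDr dotX_nondeg).
rewrite eqxx big1 ?addr0 ?mulr1n => [|y /negPf y0].
  by rewrite natrM mulr_natr.
by rewrite (sum_sgn_dot dotXDl dotXDr dotX_nondeg) y0.
Qed.

(** Exactly one of q and its product with [r] has t = 1, and only there does [bit] depend on j;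
    adding 1 to j therefore negates each term. *)
Lemma autocorr1 zeta (r : T) : r.2.2 != 0 ->
  \sum_q sgn (bit q) * sgn (bit (mulT zeta q r)) = 0.
Proof.
move=> r0; apply: int_eqNr; rewrite {1}(reindex_inj (addIr (0, (1, 0)))) -sumrN.
apply: eq_bigr => -[e [j t]] _; rewrite -!sgnD -mulN1r -[-1]/(sgn 1) -sgnD.
congr sgn; rewrite /bit /mulT /= !addr0 (F2_neq0 r0).
have [->|/F2_neq0->] := eqVneq t 0; rewrite ?add0r ?F2_addrr ?eqxx /=; ring.
Qed.

(** No twist occurs as [r] lies in H. The half t = 0 gives the autocorrelation of [Q], the half t =
    1 that of [Q'] with the sign of k; summing over j doubles both. *)
Lemma autocorr0 zeta (r : T) : r.2.2 = 0 ->
  \sum_q sgn (bit q) * sgn (bit (mulT zeta q r))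
    = #|E|%:R * ((r.1 == 0)%R%:R + sgn r.2.1 *+ (polar' r.1 == 0)%R) *+ 2.
Proof.
case: r => h [k t] /= ->; rewrite sum_T /bit /mulT /=.
rewrite mulrDr mulrnDl; congr (_ + _).
  rewrite mulr_natr -sum_sgn_Q -sumrMnl; apply: eq_bigr => e _.
  by rewrite !mulr0 !addr0 mulr2n.
rewrite mulrnAr -mulrnAl -sum_sgn_Q' mulr_suml -sumrMnl.
apply: eq_bigr => e _; rewrite !mulr0 !addr0 mulr2n.
congr (_ + _); rewrite -!sgnD; congr sgn; first by ring.
(* The two sides differ by 1 + 1, which [ring] does not simplify to 0. *)
by rewrite -[RHS]addr0 -(F2_addrr 1); ring.
Qed.

End Model.

(** * From sign sums to cardinals *)

Section Counting.

Import GRing.Theory Num.Theory.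
Local Open Scope ring_scope.

Variables (gT : finGroupType) (f : gT -> 'F_2).

(** Expand (1 + a)(1 + b), which is 4 when both signs are 1 and 0 otherwise. *)
Lemma card_shared (w : gT) :
  (#|shared [set g | f g == 0%R] w| * 4)%N%:R
    = #|gT|%:R + (\sum_g sgn (f g)) *+ 2 + \sum_g sgn (f g) * sgn (f (g * w)%g).
Proof.
rewrite natrM natr_card natr_cardT mulr_suml mulr2n.
have shift : \sum_g sgn (f g) = \sum_g sgn (f (g * w)%g).
  exact: (reindex_inj (mulIg w)).
rewrite {2}shift addrA -!big_split /=.
apply: eq_bigr => g _; rewrite !inE; set a := sgn _; set b := sgn _.
transitivity ((1 + a) * (1 + b)); last by ring.
by rewrite /a /b !sgn_eq0; do 2 case: (_ == 0).
Qed.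

End Counting.

(** * The graph on a group with coordinate law [mulT] *)

Section Construction.

Import GRing.Theory Num.Theory.
Local Open Scope ring_scope.

Lemma card_X m : #|X m| = (2 ^ m.+2)%N.
Proof. by rewrite !card_prod card_mx card_F2 mul1n !expnS mulnA. Qed.

Variables (m : nat) (gT : finGroupType) (zeta : 'F_2).
Variables (Phi : T m -> gT) (psi : gT -> T m).
Hypotheses (PhiK : cancel Phi psi) (psiK : cancel psi Phi).
Hypothesis PhiM : forall q r, Phi (mulT zeta q r) = (Phi q * Phi r)%g.

Let n := m.+2.

Lemma psiM g h : psi (g * h)%g = mulT zeta (psi g) (psi h).
Proof. by rewrite -(PhiK (mulT _ _ _)) PhiM !psiK. Qed.

Lemma scale0 : scale m 0 = 0. Proof. by []. Qed.

Lemma mulT00 : mulT zeta (0 : T m) 0 = 0.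
Proof. by rewrite /mulT /= mulr0 scale0 !addr0. Qed.

Lemma Phi0 : Phi 0 = 1%g.
Proof. by apply: (mulgI (Phi 0)); rewrite -PhiM mulT00 mulg1. Qed.

Lemma psi1 : psi 1%g = 0. Proof. by rewrite -Phi0 PhiK. Qed.

Lemma T_addrr (q : T m) : q + q = 0.
Proof.
have XX (x : X m) : x + x = 0.
  case: x => -[i j] u; congr (_, _, _); rewrite ?F2_addrr //.
  by apply/matrixP=> r s; rewrite !mxE F2_addrr.
by case: q => -[x y] [j t]; congr (_, _, (_, _)); rewrite ?XX ?F2_addrr.
Qed.

Lemma E_addrr (e : E m) : e + e = 0.
Proof. by have /(congr1 fst) := T_addrr (e, 0). Qed.

Lemma psiV g (q := psi g) :
  psi g^-1%g = (q.1 + scale m (zeta * q.2.2 * q.2.2), q.2).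
Proof.
rewrite -[RHS]PhiK; congr psi; apply: (mulgI g).
rewrite mulgV -[in RHS](psiK g) -PhiM -Phi0 /mulT /= -/q; congr Phi; congr (_, _).
  by rewrite -addrA E_addrr addr0 E_addrr.
by have /(congr1 snd) := T_addrr q.
Qed.

Definition gbit (g : gT) : 'F_2 := bit (psi g).
Definition D : {set gT} := [set g | gbit g == 0].

Lemma D1 : 1%g \in D.
Proof. by rewrite inE /gbit psi1 /bit /Q /= (dotx0 (@dotXDr m)). Qed.

(** Inversion changes coordinates only when t = 1, and then by an element of M, under which [Q'] is
    invariant. *)
Lemma DV : (D^-1)%g = D.
Proof.
apply/setP=> g; rewrite !inE /gbit psiV /bit /=.
have [->|_] := eqVneq (psi g).2.2 0; first by rewrite mulr0 scale0 addr0.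
rewrite Q'_polar (eqP (polar'_scale _ _)) (Q'_radical (polar'_scale _ _)).
by rewrite (dotx0 (@dotEDr m)) !addr0.
Qed.

Lemma sum_psi (F : T m -> int) : \sum_g F (psi g) = \sum_q F q.
Proof. by rewrite [RHS](reindex psi) //; exists Phi => q _. Qed.

Lemma card_gT : #|gT| = (2 ^ (2 * n + 2))%N.
Proof.
rewrite -(bij_eq_card (Bijective PhiK psiK)) card_prod.
rewrite [#|E m|]card_prod card_X card_prod card_F2.
by rewrite -[(2 * 2)%N]/(2 ^ 2)%N mulnn -expnM -expnD mulnC.
Qed.

Lemma sum_gbit : \sum_g sgn (gbit g) = (2 ^ n.+1)%N%:R.
Proof.
by rewrite (sum_psi (fun q => sgn (bit q))) sum_sgn_bit card_X -expnSr.
Qed.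

Lemma card_D : #|D| = ((2 ^ n.+1 - 1) * (2 ^ n + 1)).+1%N.
Proof.
apply/eqP; rewrite -(eqn_pmul2r (isT : (0 < 2)%N)) -(eqr_nat int).
rewrite card_F2_zeros sum_gbit card_gT -natrD eqr_nat.
have : (0 < 2 ^ n)%N by rewrite expn_gt0.
rewrite mul2n -addnn !expnD !(expnS 2 n); move: (2 ^ n)%N => N N0.
by apply/eqP; case: N N0 => // k _; nia.
Qed.

Lemma card_shared_D w (r := psi w) :
  (#|shared D w| * 4)%N%:R = (2 ^ (2 * n + 2) + 2 ^ n.+1 * 2)%N%:R
    + \sum_q sgn (bit q) * sgn (bit (mulT zeta q r)) :> int.
Proof.
rewrite card_shared sum_gbit card_gT natrD natrM mulr_natr -sum_psi.
by congr (_ + _); apply: eq_bigr => g _; rewrite /gbit psiM.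
Qed.

Lemma card_shared_adj w : w \in D -> w != 1%g ->
  #|shared D w| = (2 * (2 ^ n - 1) * (2 ^ (n - 1) + 1)).+2%N.
Proof.
move=> Dw w1.
have A0 : \sum_q sgn (bit q) * sgn (bit (mulT zeta q (psi w))) = 0.
  have [t0|/autocorr1->//] := eqVneq (psi w).2.2 0.
  rewrite autocorr0 //; move: Dw; rewrite inE /gbit /bit t0 eqxx => /eqP Q0.
  (* If h is nonzero, [Q] vanishing at h keeps it out of M, so both terms are 0; if h = 0, then k =
     1 and the two terms cancel. *)
  have [h0|h0] := eqVneq (psi w).1 0; last first.
    case: (boolP (polar' _ == 0)) => [/Q_radical/(_ Q0) e0|_].
      by rewrite e0 eqxx in h0.
    by rewrite addr0 mulr0 mul0rn.
  have /F2_neq0-> : (psi w).2.1 != 0.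
    apply: contraNneq w1 => j0; rewrite -(psiK w) -Phi0; apply/eqP; congr Phi.
    by move: h0 j0 t0; case: (psi w) => h [j t] /= -> -> ->.
  by rewrite h0 (polar'_scale _ 0) subrr mulr0 mul0rn.
apply/eqP; rewrite -(eqn_pmul2r (isT : (0 < 4)%N)) -(eqr_nat int).
rewrite card_shared_D A0 addr0 eqr_nat.
have -> : (n - 1 = m.+1)%N by rewrite subn1.
have : (0 < 2 ^ m.+1)%N by rewrite expn_gt0.
rewrite mul2n -addnn !expnD /n (expnS _ m.+2) (expnS _ m.+1).
move: (2 ^ m.+1)%N => N N0.
by apply/eqP; case: N N0 => // k _; nia.
Qed.

Definition clique_set : {set gT} :=
  [set g | ((psi g).1.2 == 0) && ((psi g).2.2 == 0)].

Lemma clique_set_group : group_set clique_set.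
Proof.
apply/group_setP; split=> [|g h]; first by rewrite inE psi1 !eqxx.
rewrite !inE psiM /= => /andP[/eqP g1 /eqP g2] /andP[/eqP h1 /eqP h2].
by rewrite g1 g2 h1 h2 mulr0 !add0r !eqxx.
Qed.

Definition C : {group gT} := Group clique_set_group.

Lemma CD : C \subset D.
Proof.
apply/subsetP=> g; rewrite !inE /gbit /bit => /andP[/eqP y0 ->].
by rewrite /Q y0 (dotx0 (@dotXDr m)).
Qed.

Definition embC (p : X m * 'F_2) : gT := Phi ((p.1, 0), (p.2, 0)).

Lemma embC_inj : injective embC.
Proof.
move=> [x j] [x' j'] /(can_inj PhiK) E.
by congr (_, _); [have := congr1 (fun q : T m => q.1.1) E
                | have := congr1 (fun q : T m => q.2.1) E].
Qed.

Lemma C_embC : C = embC @: setT :> {set gT}.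
Proof.
apply/setP=> g; apply/idP/imsetP => [|[[x j] _ ->]]; rewrite inE; last first.
  by rewrite PhiK !eqxx.
case/andP=> /eqP y0 /eqP t0; exists ((psi g).1.1, (psi g).2.1) => //.
rewrite -[LHS]psiK /embC; congr Phi.
by move: y0 t0; case: (psi g) => -[x y] [j t] /= -> ->.
Qed.

Lemma card_C : #|C| = (2 ^ n.+1)%N.
Proof.
rewrite C_embC card_imset ?cardsT; last exact: embC_inj.
by rewrite card_prod card_X card_F2 -expnSr.
Qed.

(** Half of the coset lies in [D]: for t = 0 the bit is affine and nonconstant in x, for t = 1 it
    flips with j. *)
Lemma card_D_coset g : g \notin C -> #|D :&: (C :* g)%g| = (2 ^ n)%N.
Proof.
move=> nCg.
have -> : D :&: (C :* g)%g
    = (fun p => embC p * g)%g @: [set p | gbit (embC p * g)%g == 0].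
  apply/setP=> h; rewrite !inE; apply/andP/imsetP => [[Dh]|[p + ->]].
    rewrite mem_rcoset C_embC => /imsetP[p _ hp].
    by exists p; rewrite ?inE -?hp mulgKV.
  rewrite inE => Dh; split=> //.
  by rewrite mem_rcoset mulgK C_embC imset_f ?inE.
rewrite card_imset => [|p p' /mulIg /embC_inj //].
apply/eqP; rewrite -(eqn_pmul2r (isT : (0 < 2)%N)) -(eqr_nat int).
rewrite card_F2_zeros card_prod card_X card_F2 -!expnSr.
set S := \sum_p _; suff -> : S = 0 by rewrite addr0.
rewrite {}/S.
move: nCg; rewrite inE negb_and /gbit.
have [t0|/F2_neq0 t1] := eqVneq (psi g).2.2 0; rewrite ?orbF ?orbT => y0.
  pose F x := sgn (dotX x (psi g).1.2 + dotX (psi g).1.1 (psi g).1.2).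
  transitivity (\sum_(p : X m * 'F_2) F p.1).
    apply: eq_bigr => p _; rewrite psiM PhiK /mulT /bit /= t0 !mulr0 scale0.
    by rewrite !addr0 eqxx /Q /= add0r dotXDl.
  rewrite -(pair_bigA _ (fun x _ => F x)) exchange_big big1 // => j _ /=.
  under eq_bigr do rewrite /F sgnD.
  rewrite -mulr_suml (sum_sgn_dot (@dotXDl m) (@dotXDr m) (@dotX_nondeg m)).
  by rewrite (negPf y0) mul0r.
apply: int_eqNr; rewrite {1}(reindex_inj (addIr (0, 1))) -sumrN.
apply: eq_bigr => p _; rewrite !psiM !PhiK /mulT /bit /= t1 !addr0 !add0r /=.
by rewrite -mulN1r -[-1]/(sgn 1) -sgnD; congr sgn; ring.
Qed.

Lemma model_cayley : exists G : sgraph gT,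
  [/\ is_cayley_graph G, strictly_neumaier G
    & neumaier_params G (2 ^ (2 * n + 2)) ((2 ^ n.+1 - 1) * (2 ^ n + 1))
        (2 * (2 ^ n - 1) * (2 ^ (n - 1) + 1)) (2 ^ n) (2 ^ n.+1)].
Proof.
exists (cayley DV).
(* The first witness lies in M minus 0, where the autocorrelation is 2 q^2; the second has t = 1,
   where it is 0. *)
have := @cayley_strictly_neumaier _ D D1 DV C _ _ _
   (Phi (scale m 1, 0)) (Phi (0, (1, 1))).
rewrite card_gT card_C; apply.
- exact: card_D.
- exact: card_shared_adj.
- exact: CD.
- by rewrite expn_gt0.
- exact: card_D_coset.
- by rewrite inE /gbit PhiK /bit /Q /scale /dotX /= dot0U !mulr0 mul1r !addr0.
- by rewrite inE /gbit PhiK /bit /Q' /al /be /= dot0U !addr0 mulr0.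
move/(congr1 (fun k => (k * 4)%N%:R : int)); rewrite !card_shared_D => /addrI.
rewrite !PhiK (@autocorr1 _ _ (0, (1, 1))) // autocorr0 //= polar'_scale.
rewrite -[#|_|]/#|E m| card_prod card_X add0r => /eqP.
by rewrite mulrn_eq0 mulf_eq0 pnatr_eq0 muln_eq0 expn_eq0.
Qed.

End Construction.

(** * Coordinates on an abstract group *)

Section Parametrization.

Import GRing.Theory.
Local Open Scope ring_scope.

Variable m : nat.

(** Coordinates on H modulo the line of z, of dimension 2n. *)
Definition K : finZmodType :=
  ('F_2 * 'rV['F_2]_m * ('F_2 * 'F_2 * 'rV['F_2]_m * 'F_2))%type.

Lemma K_abelem : 2.-abelem%g [set: K].
Proof.
apply/abelemP=> //; split.
  by apply/centsP=> x _ y _; apply: (addrC x y).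
move=> x _; apply: (etrans (expgS x 1)); rewrite expg1.
case: x => -[x2 u] [[[y1 y2] v] j].
have U2 (w : 'rV['F_2]_m) : w + w = 0.
  by apply/matrixP=> r s; rewrite !mxE F2_addrr.
by congr (_, _, (_, _, _, _)); rewrite ?[LHS]F2_addrr ?[LHS]U2.
Qed.

Lemma card_K : #|[set: K]| = (2 ^ (2 * m.+2))%N.
Proof.
rewrite cardsT !card_prod !card_mx card_F2 !mul1n.
have -> : (2 * m.+2 = m + m + 4)%N by lia.
by rewrite !expnD; ring.
Qed.

Variables (gT : finGroupType) (B H : {group gT}) (z t : gT) (zeta : 'F_2).
Variable phi : {morphism [set: K] >-> gT}.
Hypotheses (abelG : abelian [set: gT]) (inj_phi : ('injm phi)%g)
  (im_phi : (phi @* [set: K] = B)%g) (defH : (<[z]> \x B = H)%g)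
  (oz : #[z]%g = 2%N) (notHt : t \notin H) (t2 : (t ^+ 2 = z ^+ zeta)%g).

Lemma mulg_abelC (x y : gT) : (x * y = y * x)%g.
Proof. exact: (centsP abelG). Qed.

Lemma mulg_abelACA (w x y u : gT) : (w * x * (y * u) = w * y * (x * u))%g.
Proof. by rewrite -!mulgA (mulgA x) (mulg_abelC x y) -!mulgA. Qed.

Lemma phiD (x y : K) : phi (x + y) = (phi x * phi y)%g.
Proof. by rewrite -morphM ?inE. Qed.

(* The shift [q.1.2.1.1 + q.1.1.1.1] makes [param (scale 1, 0)] equal to [z]. *)
Definition coordK (q : T m) : K :=
  ((q.1.1.1.2, q.1.1.2), (q.1.2.1.1 + q.1.1.1.1, q.1.2.1.2, q.1.2.2, q.2.1)).

Lemma coordK_mulT (q r : T m) : coordK (mulT zeta q r) = coordK q + coordK r.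
Proof.
rewrite /coordK /mulT /=; congr (_, _, (_, _, _, _)); rewrite ?addr0 //.
(* The twist enters both x1 and y1, hence cancels in their sum. *)
by rewrite /= -[RHS]addr0 -(F2_addrr (zeta * q.2.2 * r.2.2)); ring.
Qed.

Definition param (q : T m) : gT :=
  (z ^+ q.1.1.1.1 * phi (coordK q) * t ^+ q.2.2)%g.

Lemma expgF2 (x : gT) (a b : 'F_2) :
  (x ^+ 2 = 1 -> x ^+ (a + b)%R = x ^+ a * x ^+ b)%g.
Proof. by move=> x2; rewrite -expgD /= expg_mod. Qed.

Lemma expt (a b : 'F_2) :
  (t ^+ a * t ^+ b = z ^+ (zeta * a * b)%R * t ^+ (a + b)%R)%g.
Proof.
have [->|/F2_neq0->] := eqVneq a 0; first by rewrite mulr0 mul0r add0r !mul1g.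
have [->|/F2_neq0->] := eqVneq b 0; first by rewrite mulr0 addr0 mul1g mulg1.
by rewrite F2_addrr !mulr1 mulg1 -t2.
Qed.

Lemma paramM (q r : T m) : param (mulT zeta q r) = (param q * param r)%g.
Proof.
have z2 : (z ^+ 2 = 1)%g by rewrite -oz expg_order.
rewrite /param coordK_mulT phiD.
have -> : (mulT zeta q r).1.1.1.1
  = q.1.1.1.1 + (r.1.1.1.1 + zeta * q.2.2 * r.2.2) by [].
have -> : (mulT zeta q r).2.2 = q.2.2 + r.2.2 by [].
rewrite !(expgF2 _ _ z2) [RHS]mulg_abelACA.
rewrite [in RHS](mulg_abelACA (z ^+ q.1.1.1.1)%g) expt.
set a := (z ^+ nat_of_ord (zeta * _ * _)%R)%g; set b := (phi _ * _)%g.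
by rewrite [RHS]mulgA -(mulgA _ b a) (mulg_abelC b a) !mulgA.
Qed.

Lemma phi_B k : phi k \in B.
Proof. by rewrite -im_phi mem_morphim ?inE. Qed.

(** The exponent of [t] is read off from the coset of H, that of [z] from the trivial intersection
    with [B], and the rest from injectivity of [phi]. *)
Lemma param_inj : injective param.
Proof.
have [_ defzB _ tiB] := dprodP defH.
have zB (x : 'F_2) k : ((z ^+ x)%g * phi k)%g \in H.
  by rewrite -defzB mem_mulg ?mem_cycle ?phi_B.
move=> q r; rewrite /param => eq_qr.
have eqt : q.2.2 = r.2.2.
  apply/eqP; apply: contraNT notHt => neq.
  have : (t ^+ q.2.2 * (t ^+ r.2.2)^-1)%g \in H.
    rewrite -(groupMl _ (zB q.1.1.1.1 (coordK q))) mulgA eq_qr mulgK; exact: zB.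
  move: neq; have [->|/F2_neq0->] := eqVneq q.2.2 0.
    have [->|/F2_neq0->] := eqVneq r.2.2 0; rewrite ?eqxx // => _.
    by rewrite mul1g groupV.
  have [->|/F2_neq0->] := eqVneq r.2.2 0; rewrite ?eqxx // => _.
  by rewrite invg1 mulg1.
move: eq_qr; rewrite eqt => /mulIg eq_qr.
have : ((z ^+ r.1.1.1.1)^-1 * z ^+ q.1.1.1.1)%g \in (<[z]> :&: B)%g.
  rewrite inE groupM ?groupV ?mem_cycle //=.
  rewrite -(mulgK (phi (coordK q)) (z ^+ q.1.1.1.1)%g) eq_qr -!mulgA mulKg.
  by rewrite groupM ?groupV ?phi_B.
rewrite tiB inE -eq_mulVg1 => /eqP eqz; rewrite eqz in eq_qr.
move/mulgI/(injmP inj_phi): eq_qr => /(_ (in_setT _) (in_setT _)).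
move=> eqk; move/eqP: eqz; rewrite eq_expg_mod_order oz.
rewrite !modn_small ?ltn_ord // => /eqP/val_inj/esym eqx {zB}.
case: q r eqt eqx eqk => -[[[x1 x2] u] [[y1 y2] v]] [j e].
case=> -[[[x1' x2'] u'] [[y1' y2'] v']] [j' e'] /= -> -> eqk.
have -> : x2 = x2' := congr1 (fun k : K => k.1.1) eqk.
have -> : u = u' := congr1 (fun k : K => k.1.2) eqk.
have -> : y1 = y1' := addIr _ (congr1 (fun k : K => k.2.1.1.1) eqk).
have -> : y2 = y2' := congr1 (fun k : K => k.2.1.1.2) eqk.
have -> : v = v' := congr1 (fun k : K => k.2.1.2) eqk.
by have -> : j = j' := congr1 (fun k : K => k.2.2) eqk.
Qed.

Lemma param_bij : #|gT| = (2 ^ (2 * m.+2 + 2))%N -> bijective param.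
Proof.
move=> cardG; apply: inj_card_bij param_inj _.
rewrite cardG card_prod [#|E m|]card_prod card_X card_prod card_F2.
by rewrite -[(2 * 2)%N]/(2 ^ 2)%N mulnn -expnM -expnD mulnC.
Qed.

End Parametrization.

(** * Choosing coordinates in the given group *)

Lemma sqr_index2 (gT : finGroupType) (H : {group gT}) (t : gT) :
  abelian [set: gT] -> #|[set: gT] : H|%g = 2 -> (t ^+ 2)%g \in H.
Proof.
move=> abelG iH; have nH x : x \in 'N(H)%g.
  by apply: (subsetP (sub_abelian_norm abelG (subsetT H))); rewrite inE.
have cardQ : #|([set: gT] / H)%g| = 2.
  by rewrite card_quotient // sub_abelian_norm ?subsetT.
rewrite coset_idr // morphX //= -cardQ; apply: expg_cardG.
by rewrite mem_quotient ?inE.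
Qed.

Theorem theorem1p2 (n : nat) (n_gt0 : 0 < n) (n_even : ~~ odd n)
    (gT : finGroupType) (abelG : abelian [set: gT])
    (cardG : #|[set: gT]| = 2 ^ (2 * n + 2))
    (exH : exists H : {group gT}, is_abelem H /\ #|[set: gT] : H|%g = 2) :
  exists X : sgraph gT,
    [/\ is_cayley_graph X, strictly_neumaier X
      & neumaier_params X (2 ^ (2 * n + 2))
          ((2 ^ n.+1 - 1) * (2 ^ n + 1))
          (2 * (2 ^ n - 1) * (2 ^ (n - 1) + 1))
          (2 ^ n) (2 ^ n.+1)].
Proof.
(* A positive even n is at least 2, which leaves room for M. *)
case: n n_gt0 n_even cardG => [|[|m]] // _ _ cardG.
have [H [abelemH iH]] := exH.
have cardH : #|H| = 2 ^ (2 * m.+2).+1.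
  apply/eqP; rewrite -(eqn_pmul2r (isT : 0 < 2)) -{1}iH Lagrange ?subsetT //.
  by rewrite cardG addn2 [X in _ == X]mulnC -expnS.
have aH : (2.-abelem H)%g.
  by move: abelemH; rewrite /is_abelem cardH /= pdiv_pfactor.
have [t _ tH] : exists2 t, t \in [set: gT] & t \notin H.
  apply/subsetPn/negP => /subset_leq_card.
  rewrite -(Lagrange (subsetT H)) iH muln2 -addnn -[X in _ <= X]addn0.
  by rewrite leq_add2l leqNgt cardG_gt0.
have t2H := sqr_index2 t abelG iH.
(* If [t] squares to 1, any nontrivial [z] in [H] serves with [zeta = 0]; otherwise [z] is that
   square and [zeta = 1]. *)
have [z [zeta [Hz z1 t2]]] : exists z (zeta : 'F_2),
    [/\ z \in H, z != 1%g & (t ^+ 2 = z ^+ zeta)%g].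
  have [t21|nt2] := eqVneq (t ^+ 2)%g 1%g; last by exists (t ^+ 2)%g, 1%R.
  have /trivgPn[z Hz z1] : H :!=: 1%g.
    by rewrite -cardG_gt1 cardH -{1}(expn0 2) ltn_exp2l.
  by exists z, 0%R.
have oz : #[z]%g = 2 by apply: (abelem_order_p aH).
(* A complement of the line of [z] in [H] is elementary abelian of the order of [K], hence
   isomorphic to it. *)
have [B [sBH cardB defH]] := p_abelem_split1 aH Hz.
have : [set: K m] \isog B.
  rewrite (isog_abelem_card _ (K_abelem m)) (abelemS sBH aH) /=.
  by rewrite card_K cardB oz cardH expnS mulKn.
case/isogP=> phi inj_phi im_phi.
have [psi PhiK psiK] := param_bij inj_phi im_phi defH oz tH
  (etrans (esym (cardsT _)) cardG).
by apply: (model_cayley (zeta := zeta) PhiK psiK) => q r; apply: paramM.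
Qed.
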